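(* Let $\alpha\in(0,1)$. If the separation distances $\bar\kappa_{\text{in-in}}$ and $\bar\kappa_{\text{in-out}}$ corresponding to $(\theta^\#,\sigma^\#,\pi^* )$ satisfy $$\min\{\bar\kappa_{\text{in-in}},\bar\kappa_{\text{in-out}}\}\ \ge\ 4\max\Big\{\big(d\log(4nm/\alpha)\big)^{1/4},\ \big(2\log(8nm/\alpha)\big)^{1/2}\Big\},$$ then the LSNS estimator $\hat\pi^{\mathrm{LSNS}}_{n,m}$ detects the true matching map $\pi^*$ with probability at least $1-\alpha$, that is, $$\mathbf P_{\theta^\#,\sigma^\#,\pi^*}\big(\hat\pi^{\mathrm{LSNS}}_{n,m}=\pi^*\big)\ge 1-\alpha.$$
   Context: Notation: $[n]=\{1,\dots,n\}$; $\|\cdot\|$ is the Euclidean norm on $\mathbb R^d$. Model. Let $m>n\ge 2$ and $d\ge1$ be integers. The parameters are $\theta^\#=(\theta^\#_1,\dots,\theta^\#_m)$ with $\theta^\#_j\in\mathbb R^d$, $\sigma^\#=(\sigma^\#_1,\dots,\sigma^\#_m)$ with $\sigma_j^\#>0$, and an injective map $\pi^*:[n]\to[m]$. For $i\in[n]$ put $\theta_i=\theta^\#_{\pi^*(i)}$ and $\sigma_i=\sigma^\#_{\pi^*(i)}$. One observes $$X_i=\theta_i+\sigma_i\xi_i\ (i\in[n]),\qquad X^\#_j=\theta^\#_j+\sigma^\#_j\xi^\#_j\ (j\in[m]),$$ where $\xi_1,\dots,\xi_n,\xi^\#_1,\dots,\xi^\#_m$ are independent standard Gaussian vectors in $\mathbb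 R^d$ (zero mean, identity covariance). The law of $(X_1,\dots,X_n,X_1^\#,\dots,X_m^\#)$ is denoted $\mathbf P_{\theta^\#,\sigma^\#,\pi^*}$. The outlier index set is $O_{\pi^*}=[m]\setminus\mathrm{Im}(\pi^* )$. Separation distances: $$\bar\kappa_{\text{in-in}}=\min_{\substack{i,j\notin O_{\pi^*}\\ i\ne j}}\frac{\|\theta^\#_i-\theta^\#_j\|}{((\sigma^\#_i)^2+(\sigma^\#_j)^2)^{1/2}},\qquad \bar\kappa_{\text{in-out}}=\min_{\substack{i\notin O_{\pi^*}\\ j\in O_{\pi^*}}}\frac{\|\theta^\#_i-\theta^\#_j\|}{((\sigma^\#_i)^2+(\sigma^\#_j)^2)^{1/2}}.$$ LSNS (least sum of normalized squares) estimator (noise levels $\sigma_i,\sigma_j^\#$ are known): $$\hat\pi^{\mathrm{LSNS}}_{n,m}\in\arg\min_{\pi:[n]\to[m]}\sum_{i=1}^n\frac{\|X_i-X^\#_{\pi(i)}\|^2}{\sigma_i^2+(\sigma^\#_{\pi(i)})^2},$$ the minimum being over all injective maps $\pi:[n]\to[m]$. *)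

(* Defs.v *)
From HB Require Import structures.
From mathcomp Require Import all_boot all_order all_algebra.
From mathcomp Require Import all_classical all_reals all_analysis.
Set Implicit Arguments.
Unset Strict Implicit.
Unset Printing Implicit Defensive.
Import Order.TTheory GRing.Theory Num.Theory.
Import numFieldNormedType.Exports.

Local Open Scope classical_set_scope.
Local Open Scope ring_scope.

(* The library norm on 'rV is the sup norm, hence a separate Euclidean norm. *)
Definition enorm (R : realType) (d : nat) (v : 'rV[R]_d) : R :=
  Num.sqrt (\sum_(k < d) v ord0 k ^+ 2).

Definition mutually_independent (disp disp' : measure_display)
    (T : measurableType disp) (U : measurableType disp') (R : realType)
    (P : probability T R) (I : finType) (X : I -> T -> U) : Prop :=
  forall (J : {set I}) (A : I -> set U), (forall i, measurable (A i)) ->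
    P [set w | forall i, i \in J -> A i (X i w)] =
    (\prod_(i in J) P (X i @^-1` A i))%E.

(* R^d is represented by d.-tuple R, which carries the product (= Borel)
   sigma-algebra; normal_prob takes the mean and the standard deviation. *)
Definition standard_gaussian (disp : measure_display) (T : measurableType disp)
    (R : realType) (P : probability T R) (d : nat)
    (X : {RV P >-> d.-tuple R}) : Prop :=
  (forall (k : 'I_d) (A : set R), measurable A ->
     P [set w | A (tnth (X w) k)] = normal_prob 0 1 A) /\
  mutually_independent P (fun (k : 'I_d) (w : T) => tnth (X w) k).

Definition noise_family (disp : measure_display) (T : measurableType disp)
    (R : realType) (P : probability T R) (n m d : nat)
    (xi : 'I_n -> {RV P >-> d.-tuple R}) (xis : 'I_m -> {RV P >-> d.-tuple R})
    (k : 'I_n + 'I_m) : T -> d.-tuple R :=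
  match k with inl i => xi i | inr j => xis j end.

Definition independent_standard_gaussians (disp : measure_display)
    (T : measurableType disp) (R : realType) (P : probability T R)
    (n m d : nat) (xi : 'I_n -> {RV P >-> d.-tuple R})
    (xis : 'I_m -> {RV P >-> d.-tuple R}) : Prop :=
  [/\ forall i, standard_gaussian (xi i),
      forall j, standard_gaussian (xis j) &
      mutually_independent P (noise_family xi xis)].

Definition observation (R : realType) (d : nat) (theta : 'rV[R]_d) (sigma : R)
    (z : d.-tuple R) : 'rV[R]_d :=
  theta + sigma *: (\row_(k < d) tnth z k).

Definition outliers (n m : nat) (pistar : {ffun 'I_n -> 'I_m}) : {set 'I_m} :=
  finset.setC [set pistar i | i : 'I_n]%SET.

Definition separation (R : realType) (m d : nat) (thetas : 'I_m -> 'rV[R]_d)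
    (sigmas : 'I_m -> R) (i j : 'I_m) : R :=
  enorm (thetas i - thetas j) / Num.sqrt (sigmas i ^+ 2 + sigmas j ^+ 2).

(* +oo is the minimum over an empty range, excluded when 2 <= n < m and pistar
   is injective. *)
Definition kappa_in_in (R : realType) (n m d : nat)
    (thetas : 'I_m -> 'rV[R]_d) (sigmas : 'I_m -> R)
    (pistar : {ffun 'I_n -> 'I_m}) : \bar R :=
  \big[Order.min/+oo%E]_(p : 'I_m * 'I_m |
      [&& p.1 \notin outliers pistar, p.2 \notin outliers pistar
        & p.1 != p.2])
    (separation thetas sigmas p.1 p.2)%:E.

Definition kappa_in_out (R : realType) (n m d : nat)
    (thetas : 'I_m -> 'rV[R]_d) (sigmas : 'I_m -> R)
    (pistar : {ffun 'I_n -> 'I_m}) : \bar R :=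
  \big[Order.min/+oo%E]_(p : 'I_m * 'I_m |
      (p.1 \notin outliers pistar) && (p.2 \in outliers pistar))
    (separation thetas sigmas p.1 p.2)%:E.

Definition lsns_cost (R : realType) (n m d : nat) (sigma : 'I_n -> R)
    (sigmas : 'I_m -> R) (x : 'I_n -> 'rV[R]_d) (xs : 'I_m -> 'rV[R]_d)
    (f : {ffun 'I_n -> 'I_m}) : R :=
  \sum_(i < n) enorm (x i - xs (f i)) ^+ 2 / (sigma i ^+ 2 + sigmas (f i) ^+ 2).

Definition is_lsns (R : realType) (n m d : nat) (sigma : 'I_n -> R)
    (sigmas : 'I_m -> R) (x : 'I_n -> 'rV[R]_d) (xs : 'I_m -> 'rV[R]_d)
    (f : {ffun 'I_n -> 'I_m}) : Prop :=
  injective f /\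
  forall g : {ffun 'I_n -> 'I_m}, injective g ->
    lsns_cost sigma sigmas x xs f <= lsns_cost sigma sigmas x xs g.

(* Main.v *)
Require Import Defs.
From HB Require Import structures.
From mathcomp Require Import all_boot all_order all_algebra.
From mathcomp Require Import all_classical all_reals all_analysis.
From mathcomp Require Import measurable_realfun lebesgue_integral_fubini ring lra.
Import Order.TTheory GRing.Theory Num.Theory.
Import numFieldNormedType.Exports HBNNSimple.
Local Open Scope classical_set_scope.
Local Open Scope ring_scope.

(** Write V i j = |X_i - X#_j|^2 / (sigma_i^2 + sigma#_j^2), the summand of the
    least-squares cost when i is matched to j.  The difference inside is Gaussian,
    so V i j is a chi-square variable with d degrees of freedom whose
    non-centrality K is the squared separation of pistar i and j; it is central
    when j = pistar i.

    If a minimizer differs from pistar, its cost is at most that of pistar, so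
    for some i whose image j changed the summand did not increase:
    V i j <= V i (pistar i) ([lsns_neq_exists_le]).  A union bound over the
    n * m pairs reduces the theorem to bounding the probability of such a
    comparison for one fixed pair ([probability_residual_le]).

    The two sides of the comparison share the noise of X_i.  Instead of treating
    them jointly, separate them by the level s = d + 3K/8: either
    V i (pistar i) >= s or V i j <= s.  Each of the two is a Chernoff bound, at
    lam = 4L/K and -lam respectively, where L = ln (4nm/alpha).  The moment
    generating function of a non-central chi-square,
      E exp (a V) = (1 - 2a)^(-d/2) exp (a K / (1 - 2a)),
    is at most exp (d (a + 2a^2) + a K / (1 - 2a)) for |a| <= 1/8.  The
    separation hypothesis gives K >= 32 L and K^2 >= 256 d L, hence lam <= 1/8,
    lam K = 4 L and d lam^2 <= L/16, which makes both exponents at most -L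
    ([chernoff_exponents]).  So a fixed pair fails with probability at most
    2 exp (-L) = alpha / (2nm), and the union with probability at most alpha/2.

    The moment generating function ([expectation_expR_sqr_gaussian]) is computed
    without the law of a sum of Gaussians: the quadratic exponential factors over
    coordinates, Tonelli conditions on the first noise vector, and completing the
    square integrates out the second vector and then the first, each time leaving
    an exponential of the same shape. *)

(** * Integrals determined by indicators, and independence *)

(** Two linear functionals of a nonnegative h that agree on indicators agree on
    all nonnegative measurable h.  The weight w is what makes one statement serve
    several purposes: a density (X the identity, w the density), and freezing all
    but one of several independent variables (w the product of the others). *)
Lemma ge0_integral_law_weight (d1 d2 : measure_display) (T : measurableType d1)
    (U : measurableType d2) (R : realType)
    (mu : {measure set T -> \bar R}) (nu : {measure set U -> \bar R})
    (X : T -> U) (w : T -> R) (C : R) :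
  measurable_fun setT X -> measurable_fun setT w ->
  (forall x, 0 <= w x) -> 0 <= C ->
  (forall A, measurable A ->
     (\int[mu]_x ((\1_A (X x))%:E * (w x)%:E) = C%:E * nu A)%E) ->
  forall h : U -> \bar R, measurable_fun setT h -> (forall y, (0 <= h y)%E) ->
    (\int[mu]_x (h (X x) * (w x)%:E) = C%:E * \int[nu]_y h y)%E.
Proof.
move=> mX mw w0 C0 HA h mh h0.
pose f_ := nnsfun_approx measurableT mh.
have mwE : measurable_fun setT (fun x => (w x)%:E) by exact/measurable_EFinP.
have w0E x : (0 <= (w x)%:E)%E by rewrite lee_fin.
have nnE (f : {nnsfun U >-> R}) :
    (\int[mu]_x ((f (X x))%:E * (w x)%:E) = C%:E * \int[nu]_y (f y)%:E)%E.
  under eq_integral.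
    move=> x _; rewrite fimfunE -fsumEFin// ge0_mule_fsuml; last first.
      by move=> r; rewrite EFinM; exact: nnfun_muleindic_ge0.
    over.
  under [in RHS]eq_integral do rewrite fimfunE -fsumEFin//.
  have mI r : measurable_fun setT
      (fun x => (\1_(f @^-1` [set r]) (X x) : R)%:E).
    by apply/measurable_EFinP; apply: (measurableT_comp _ mX).
  rewrite ge0_integral_fsum//; last 2 first.
    - move=> r; under eq_fun do rewrite EFinM -muleA.
      by apply: measurable_funeM; exact: emeasurable_funM.
    - by move=> r x _; rewrite mule_ge0// EFinM nnfun_muleindic_ge0.
  rewrite ge0_integral_fsum//; last 2 first.
    - by move=> r; exact/measurable_EFinP/measurableT_comp.
    - by move=> r x _; rewrite EFinM nnfun_muleindic_ge0.
  rewrite ge0_mule_fsumr; last first.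
    by move=> r; apply: integral_ge0 => x _; rewrite EFinM nnfun_muleindic_ge0.
  apply: eq_fsbigr => r; rewrite inE => -[z _ <-{r}].
  under eq_integral do rewrite EFinM -muleA.
  rewrite ge0_integralZl//; last 3 first.
    - exact: emeasurable_funM.
    - by move=> x _; rewrite mule_ge0// lee_fin.
    - by rewrite lee_fin.
  rewrite HA//; under [in RHS]eq_integral do rewrite EFinM.
  rewrite ge0_integralZl//; last 2 first.
    - exact/measurable_EFinP/measurable_indic.
    - by rewrite lee_fin.
  by rewrite integral_indic// setIT muleCA.
have ndf x a b : (a <= b)%N -> f_ a x <= f_ b x.
  by move=> ab; exact/lefP/nd_nnsfun_approx.
have cvf x : (f_ n x)%:E @[n --> \oo] --> h x by exact: cvg_nnsfun_approx.
transitivity (limn (fun n => \int[mu]_x ((f_ n (X x))%:E * (w x)%:E)))%E.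
  rewrite -monotone_convergence//=.
  - by apply: eq_integral => x _; apply/esym/cvg_lim => //=; exact: cvgeZr.
  - move=> n; apply: emeasurable_funM => //; apply/measurable_EFinP.
    by apply: (measurableT_comp _ mX).
  - by move=> n x _; rewrite mule_ge0// lee_fin.
  - by move=> x _ a b ab; rewrite lee_wpmul2r// lee_fin ndf.
transitivity (limn (fun n => C%:E * \int[nu]_y (f_ n y)%:E))%E.
  by apply: congr_lim; apply/funext => n; exact: nnE.
rewrite limeMl//; last 1 first.
  apply/ereal_nondecreasing_is_cvgn => a b ab; apply: ge0_le_integral => //=.
  - by move=> ? _; rewrite lee_fin.
  - exact/measurable_EFinP.
  - exact/measurable_EFinP.
  - by move=> y _; rewrite lee_fin ndf.
rewrite -monotone_convergence//=.
- by congr (_ * _)%E; apply: eq_integral => x _; exact/cvg_lim.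
- by move=> n; exact/measurable_EFinP.
- by move=> n y _; rewrite lee_fin.
- by move=> y _ a b ab; rewrite lee_fin ndf.
Qed.

(** Starting from the product rule on events, where every factor is an indicator,
    the factors are replaced one at a time by arbitrary functions; each replacement
    is an instance of [ge0_integral_law_weight] with the other factors as weight. *)
Lemma expectation_prod_independent (disp disp' : measure_display)
    (T : measurableType disp) (U : measurableType disp') (R : realType)
    (P : probability T R) (nu : {measure set U -> \bar R})
    (I : finType) (X : I -> T -> U) :
  mutually_independent P X -> (forall k, measurable_fun setT (X k)) ->
  (forall k A, measurable A -> P (X k @^-1` A) = nu A) ->
  forall (h : I -> U -> R) (e : I -> R),
    (forall k, measurable_fun setT (h k)) -> (forall k y, 0 <= h k y) ->
    (forall k, (\int[nu]_y (h k y)%:E = (e k)%:E)%E) ->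
    (\int[P]_w (\prod_k h k (X k w))%:E = (\prod_k e k)%:E)%E.
Proof.
move=> indX mX lawX h e mh h0 he.
(* The list s holds the indices whose factor need not be an indicator. *)
suff: forall (s : seq I) (h : I -> U -> R) (e : I -> R),
    (forall k, measurable_fun setT (h k)) -> (forall k y, 0 <= h k y) ->
    (forall k, (\int[nu]_y (h k y)%:E = (e k)%:E)%E) ->
    (forall k, k \notin s -> exists2 A, measurable A & h k = \1_A) ->
    (\int[P]_w (\prod_k h k (X k w))%:E = (\prod_k e k)%:E)%E.
  by move=> /(_ (enum I)); apply => // k; rewrite mem_enum.
elim => {h e mh h0 he} [|k s IH] h e mh h0 he hs.
  have /choice[A hA] : forall k, exists A, measurable A /\ h k = \1_A.
    by move=> k; have [//|A] := hs k; exists A.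
  pose B := [set w | forall k, k \in [set: I]%SET -> A k (X k w)].
  have -> : (fun w => (\prod_k h k (X k w))%:E) = (fun w => (\1_B w)%:E).
    apply/funext => w; congr EFin.
    under eq_bigr => k _ do rewrite (hA k).2 indicE.
    have [Bw|nBw] := pselect (B w).
      rewrite indicE mem_set// big1// => k _; rewrite mem_set//.
      by apply: Bw; rewrite inE.
    rewrite indicE memNset//; move/existsNP : nBw => [k /not_implyP[_ Ak]].
    by rewrite (bigD1 k)//= memNset// mul0r.
  rewrite integral_indic//; last first.
    have -> : B = \bigcap_(k in [set: I]) (X k @^-1` A k).
      apply/seteqP; split => [w Bw k _|w Bw k _]; last exact: Bw.
      by apply: Bw; rewrite inE.
    apply: fin_bigcap_measurable => // k _; rewrite -[_ @^-1` _]setTI.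
    by apply: mX => //; case: (hA k).
  rewrite setIT.
  transitivity (\prod_(k in [set: I]%SET) P (X k @^-1` A k))%E.
    by apply: indX => k; case: (hA k).
  rewrite -prodEFin; apply: eq_big => [k|k _]; first by rewrite inE.
  rewrite lawX; last by case: (hA k).
  rewrite -he (hA k).2 integral_indic ?setIT//.
  by case: (hA k).
have e0 j : 0 <= e j.
  by rewrite -lee_fin -he integral_ge0// => y _; rewrite lee_fin.
under eq_integral => w _ do rewrite (bigD1 k)//= EFinM.
pose W w := \prod_(j | j != k) h j (X j w).
have mW : measurable_fun setT W.
  rewrite /W; under eq_fun do rewrite -big_filter.
  by apply: measurable_prod => j _; exact: measurableT_comp.
rewrite (@ge0_integral_law_weight _ _ _ _ _ P nu (X k) W (\prod_(j | j != k) e j)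
  _ _ _ _ _ (EFin \o h k))//=.
- by rewrite he -EFinM mulrC [in RHS](bigD1 k).
- by move=> w; exact: prodr_ge0.
- exact: prodr_ge0.
- move=> A mA.
  pose h' j := if j == k then \1_A else h j.
  pose e' j := if j == k then fine (nu A) else e j.
  have mXA : measurable (X k @^-1` A) by rewrite -[_ @^-1` _]setTI; exact: mX.
  have nuA : nu A \is a fin_num by rewrite -(lawX k)//; exact: fin_num_measure.
  have := IH h' e'; rewrite (bigD1 k)//= {2}/e' eqxx EFinM fineK//.
  rewrite (eq_bigr e) => [|j /negbTE jk]; last by rewrite /e' jk.
  rewrite muleC => <-.
  - apply: eq_integral => w _; rewrite (bigD1 k)//= {1}/h' eqxx EFinM.
    by congr (_ * _%:E)%E; apply: eq_bigr => j /negbTE jk; rewrite /h' jk.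
  - by move=> j; rewrite /h'; case: ifP => // _; exact: measurable_indic.
  - by move=> j y; rewrite /h'; case: ifP.
  - move=> j; rewrite /h' /e'; case: ifP => // _.
    by rewrite integral_indic// setIT fineK.
  - move=> j js; rewrite /h'; case: ifPn => [_|jk]; first by exists A.
    by apply: hs; rewrite inE negb_or jk.
- exact/measurable_EFinP.
- by move=> y; rewrite lee_fin.
Qed.

Definition independent_pair (disp d1 d2 : measure_display)
    (T : measurableType disp) (U1 : measurableType d1) (U2 : measurableType d2)
    (R : realType) (P : probability T R) (X : T -> U1) (Y : T -> U2) : Prop :=
  forall A B, measurable A -> measurable B ->
    P (X @^-1` A `&` Y @^-1` B) = (P (X @^-1` A) * P (Y @^-1` B))%E.
Arguments independent_pair {disp d1 d2 T U1 U2 R}.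

(** The joint law of an independent pair is the product of the laws, so Tonelli
    lets the two variables run over separate copies of the sample space. *)
Lemma integral_independent_pair (disp d1 d2 : measure_display)
    (T : measurableType disp) (U1 : measurableType d1) (U2 : measurableType d2)
    (R : realType) (P : probability T R)
    (X : {RV P >-> U1}) (Y : {RV P >-> U2}) :
  independent_pair P X Y ->
  forall f : U1 * U2 -> \bar R, measurable_fun setT f ->
    (forall z, (0 <= f z)%E) ->
    (\int[P]_w f (X w, Y w) = \int[P]_w \int[P]_w' f (X w, Y w'))%E.
Proof.
move=> indXY f mf f0.
pose XY w := (X w, Y w).
have mXY : measurable_fun setT XY by exact: measurable_fun_pair.
have -> : (\int[P]_w f (X w, Y w) = \int[pushforward P XY]_z f z)%E.
  by rewrite ge0_integral_pushforward.
transitivity (\int[(distribution P X \x distribution P Y)%E]_z f z)%E.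
  apply: eq_measure_integral => A mA _; apply/esym.
  by apply: product_measure_unique.
rewrite fubini_tonelli1// ge0_integral_distribution//; last 2 first.
- exact: measurable_fun_fubini_tonelli_F.
- by move=> x; exact: integral_ge0.
apply: eq_integral => w _.
transitivity (\int[distribution P Y]_y f (X w, y))%E; first by [].
rewrite ge0_integral_distribution//.
by apply: measurableT_comp => //; exact: measurable_pair1.
Qed.

(** * Gaussian integrals *)

Lemma complete_square (R : realFieldType) (a s t x v : R) :
  v = 1 - 2 * a * s ^+ 2 -> v != 0 ->
  a * (t + s * x) ^+ 2 - x ^+ 2 / 2 =
  a / v * t ^+ 2 - (x - 2 * a * s * t / v) ^+ 2 / (v^-1 * 2).
Proof.
move=> vE v0; rewrite invfM invrK.
have rv : v^-1 * v - 1 = 0 by rewrite mulVf// subrr.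
set r := v^-1 in rv *.
suff -> : a * r * t ^+ 2 - (x - 2 * a * s * t * r) ^+ 2 * (v * 2^-1) =
    a * (t + s * x) ^+ 2 - x ^+ 2 / 2 +
    (r * v - 1) * (a * t ^+ 2 + 2 * a * s * t * x - 2 * a ^+ 2 * s ^+ 2 * t ^+ 2 * r).
  by rewrite rv mul0r addr0.
by rewrite vE; field.
Qed.

Lemma integral_normal_prob01 (R : realType) (f : R -> R) :
  measurable_fun setT f -> (forall x, 0 <= f x) ->
  (\int[normal_prob 0 1]_x (f x)%:E =
   \int[lebesgue_measure]_x (f x * normal_pdf 0 1 x)%:E)%E.
Proof.
move=> mf f0.
under [RHS]eq_integral do rewrite EFinM.
rewrite (@ge0_integral_law_weight _ _ _ _ _ lebesgue_measure (normal_prob 0 1)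
  idfun (normal_pdf 0 1) 1 _ _ _ _ _ (EFin \o f)) ?mul1e//.
- exact: measurable_id.
- exact: measurable_normal_pdf.
- by move=> x; exact: normal_pdf_ge0.
- move=> A mA; rewrite mul1e [in RHS]/normal_prob [RHS]integral_mkcond.
  apply: eq_integral => x _; rewrite patchE indicE.
  by case: ifP => _; rewrite ?mul1e ?mul0e.
- exact/measurable_EFinP.
Qed.

(** The result has the shape of the integrand, an exponential of a multiple of a
    square, so the lemma can be applied again when t is affine in another
    Gaussian variable.  It holds because the integrand times the standard density
    is a multiple of the density of mean 2ast/v and variance 1/v. *)
Lemma normal_expR_sqr (R : realType) (a t s : R) : 2 * a * s ^+ 2 < 1 ->
  (\int[normal_prob 0 1]_y (expR (a * (t + s * y) ^+ 2))%:E =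
   (Num.sqrt (1 - 2 * a * s ^+ 2)^-1
    * expR (a / (1 - 2 * a * s ^+ 2) * t ^+ 2))%:E)%E.
Proof.
move=> as1; set v := 1 - _.
have v0 : 0 < v by rewrite subr_gt0.
have vn0 : v != 0 by rewrite gt_eqF.
pose q := Num.sqrt v^-1; pose m := 2 * a * s * t / v.
have q0 : 0 < q by rewrite sqrtr_gt0 invr_gt0.
have q2 : q ^+ 2 = v^-1 by rewrite sqr_sqrtr// invr_ge0 ltW.
rewrite integral_normal_prob01; last 2 first.
- apply: (measurableT_comp (@measurable_expR R)).
  apply: measurable_funM => //.
  by apply: measurable_funX; exact: measurable_funD.
- by move=> x; exact: expR_ge0.
transitivity (\int[lebesgue_measure]_x
    ((q * expR (a / v * t ^+ 2))%:E * (normal_pdf m q x)%:E))%E.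
  apply: eq_integral => x _; rewrite -EFinM; congr EFin.
  rewrite !normal_pdfE ?oner_neq0 ?gt_eqF// /normal_fun.
  have -> : normal_peak 1 = q * normal_peak q :> R.
    rewrite /normal_peak expr1n mul1r -mulrnAr sqrtrM ?sqr_ge0//.
    rewrite sqrtr_sqr gtr0_norm// invfM mulrA divff ?gt_eqF// mul1r//.
  set p := normal_peak q; set E1 := expR (a * _); set E2 := expR _.
  set E3 := expR _; set E4 := expR _.
  have -> : E1 * (q * p * E2) = q * p * (E1 * E2) by ring.
  have -> : q * E3 * (p * E4) = q * p * (E3 * E4) by ring.
  congr (_ * _); rewrite -!expRD; congr expR.
  rewrite q2 subr0 expr1n -[v^-1 *+ 2]mulr_natr !mulNr.
  exact: complete_square.
rewrite ge0_integralZl//.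
- by rewrite integral_normal_pdf mule1.
- by apply: measurableT_comp => //; exact: measurable_normal_pdf.
- by move=> x _; rewrite lee_fin normal_pdf_ge0.
- by rewrite lee_fin mulr_ge0 ?expR_ge0// ltW.
Qed.

(** Since c^2 + s^2 = 1, each c X_k + s Y_k is standard Gaussian, and the integral
    is the moment generating function of a non-central chi-square variable.  It
    is obtained by integrating Y out at coefficient a, which turns a into a / v
    with v = 1 - 2as^2, and then X at coefficient a / v; the two factors combine
    because v (1 - 2 (a / v) c^2) = 1 - 2a. *)
Lemma expectation_expR_sqr_gaussian (disp : measure_display)
    (T : measurableType disp) (R : realType) (P : probability T R) (d : nat)
    (X Y : {RV P >-> d.-tuple R}) (c s a : R) (u : 'I_d -> R) :
  standard_gaussian X -> standard_gaussian Y ->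
  independent_pair P X Y ->
  c ^+ 2 + s ^+ 2 = 1 -> 2 * a < 1 ->
  (\int[P]_w (expR (a * \sum_k (u k + c * tnth (X w) k
                                + s * tnth (Y w) k) ^+ 2))%:E =
   (Num.sqrt (1 - 2 * a)^-1 ^+ d
    * expR (a / (1 - 2 * a) * \sum_k u k ^+ 2))%:E)%E.
Proof.
move=> [lawX indX] [lawY indY] indXY cs1 a1.
have as1 : 2 * a * s ^+ 2 < 1.
  have [->|s0] := eqVneq s 0; first by rewrite expr0n mulr0.
  have : 0 < (1 - 2 * a) * s ^+ 2.
    by rewrite mulr_gt0 ?subr_gt0// lt_def sqr_ge0 expf_eq0/= s0.
  by have := sqr_ge0 c; lra.
set v := 1 - 2 * a * s ^+ 2; have v0 : 0 < v by rewrite subr_gt0.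
have vn0 : v != 0 by rewrite gt_eqF.
have cE : c ^+ 2 = 1 - s ^+ 2 by lra.
have av : 2 * (a / v) * c ^+ 2 < 1.
  by rewrite mulrA mulrAC ltr_pdivrMr// cE /v; lra.
have vE : 1 - 2 * (a / v) * c ^+ 2 = (1 - 2 * a) / v.
  by rewrite cE /v; field.
have mcoord (Z : {RV P >-> d.-tuple R}) k :
    measurable_fun setT (fun w => tnth (Z w) k).
  by apply: (measurableT_comp (measurable_tnth k)).
pose f (z : d.-tuple R * d.-tuple R) :=
  (expR (a * \sum_k (u k + c * tnth z.1 k + s * tnth z.2 k) ^+ 2))%:E.
rewrite (integral_independent_pair _ _ _ _ _ _ _ _ _ _ indXY f); first last.
- by move=> z; rewrite lee_fin expR_ge0.
- apply/measurable_EFinP; apply: (measurableT_comp (@measurable_expR R)).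
  apply: measurable_funM => //; apply: measurable_sum => k.
  apply: measurable_funX; apply: measurable_funD.
    apply: measurable_funD => //; apply: measurable_funM => //.
    by apply: (measurableT_comp (measurable_tnth k)).
  apply: measurable_funM => //.
  by apply: (measurableT_comp (measurable_tnth k)).
have mE (b t r : R) : measurable_fun setT (fun y : R => expR (b * (t + r * y) ^+ 2)).
  apply: (measurableT_comp (@measurable_expR R)).
  apply: measurable_funM => //.
  by apply: measurable_funX; exact: measurable_funD.
under eq_integral => w _.
  under eq_integral => w' _ do rewrite /f mulr_sumr expR_sum.
  rewrite (expectation_prod_independent _ _ _ _ _ _ (normal_prob 0 1) _ _ indY
    (mcoord Y) lawY (fun k y => expR (a * (u k + c * tnth (X w) k + s * y) ^+ 2))
    (fun k => Num.sqrt v^-1 * expR (a / v * (u k + c * tnth (X w) k) ^+ 2))).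
  - over.
  - by move=> k; exact: mE.
  - by move=> k y; exact: expR_ge0.
  - by move=> k; exact: normal_expR_sqr.
rewrite /=.
rewrite (expectation_prod_independent _ _ _ _ _ _ (normal_prob 0 1) _ _ indX
    (mcoord X) lawX (fun k y => Num.sqrt v^-1 * expR (a / v * (u k + c * y) ^+ 2))
    (fun k => Num.sqrt (1 - 2 * a)^-1 * expR (a / (1 - 2 * a) * u k ^+ 2))).
- congr EFin; rewrite big_split/= prodr_const card_ord -expR_sum.
  by rewrite mulr_sumr.
- by move=> k; apply: measurable_funM => //; exact: mE.
- by move=> k y; rewrite mulr_ge0 ?expR_ge0.
- move=> k; under eq_integral do rewrite EFinM.
  rewrite ge0_integralZl//; last by apply: measurableT_comp => //; exact: mE.
  rewrite normal_expR_sqr// vE -EFinM mulrA; congr (_ * expR (_ * _))%:E.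
    by rewrite -sqrtrM ?invr_ge0 1?ltW// invf_div mulrA mulVf// mul1r.
  by field; rewrite vn0 gt_eqF// subr_gt0.
Qed.

(** * Chernoff bounds for non-central chi-square variables *)

(** Second order bound for -ln (1 - 2a) / 2 = a + a^2 + ..., obtained from
    exp (2y) >= (1 + y)^2 with y = a + 2a^2; the quadratic term leaves enough
    room for the cubic one when |a| <= 1/8. *)
Lemma sqrt_inv1B_le_expR (R : realType) (a : R) : `|a| <= 1 / 8 ->
  Num.sqrt (1 - 2 * a)^-1 <= expR (a + 2 * a ^+ 2).
Proof.
rewrite ler_norml => /andP[a1 a2].
have v0 : 0 < 1 - 2 * a by lra.
rewrite -(ger0_norm (expR_ge0 _)) -sqrtr_sqr ler_sqrt ?sqr_ge0//.
set y := a + _; have y1 : 0 <= 1 + y by rewrite /y; have := sqr_ge0 a; lra.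
apply: (@le_trans _ _ ((1 + y) ^+ 2)); last first.
  by rewrite lerXn2r ?nnegrE ?expR_ge0// expR_ge1Dx.
rewrite -[leLHS]mul1r ler_pdivrMr//.
have -> : (1 + y) ^+ 2 * (1 - 2 * a) =
    1 + a ^+ 2 * (1 - 6 * a - 4 * a ^+ 2 - 8 * a ^+ 3) by rewrite /y; ring.
rewrite lerDl mulr_ge0 ?sqr_ge0//.
have a21 : a ^+ 2 <= 1 / 64.
  have : 0 <= (1 / 8 - a) * (1 / 8 + a) by apply: mulr_ge0; lra.
  lra.
have a31 : a ^+ 3 <= a ^+ 2 / 8.
  by rewrite exprS mulrC ler_wpM2l ?sqr_ge0//; lra.
by lra.
Qed.

Lemma expectation_expR_sqr_gaussian_le (disp : measure_display)
    (T : measurableType disp) (R : realType) (P : probability T R) (d : nat)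
    (X Y : {RV P >-> d.-tuple R}) (c s a : R) (u : 'I_d -> R) :
  standard_gaussian X -> standard_gaussian Y ->
  independent_pair P X Y ->
  c ^+ 2 + s ^+ 2 = 1 -> `|a| <= 1 / 8 ->
  (\int[P]_w (expR (a * \sum_k (u k + c * tnth (X w) k
                                + s * tnth (Y w) k) ^+ 2))%:E <=
   (expR (d%:R * (a + 2 * a ^+ 2)
          + a / (1 - 2 * a) * \sum_k u k ^+ 2))%:E)%E.
Proof.
move=> gX gY indXY cs1 a8.
have a1 : 2 * a < 1 by move: a8; rewrite ler_norml => /andP[]; lra.
rewrite expectation_expR_sqr_gaussian// lee_fin expRD ler_wpM2r ?expR_ge0//.
rewrite expRM_natl lerXn2r ?nnegrE ?expR_ge0//.
exact: sqrt_inv1B_le_expR.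
Qed.

(** The level t lies between the mean d of the central variable and the mean d + K
    of the other one.  With lam K = 4L and d lam^2 <= L/16, the first exponent is
    at most L/8 - 3L/2, and the second at most L/8 - 16L/5 + 3L/2. *)
Lemma chernoff_exponents (R : realType) (d : nat) (K L : R) :
  0 < L -> 32 * L <= K -> 256 * (d%:R * L) <= K ^+ 2 ->
  let lam := 4 * L / K in let t := d%:R + 3 / 8 * K in
  [/\ 0 < lam, lam <= 1 / 8,
      d%:R * (lam + 2 * lam ^+ 2) - lam * t <= - L &
      d%:R * (- lam + 2 * lam ^+ 2) - lam / (1 + 2 * lam) * K + lam * t <= - L].
Proof.
move=> L0 KL KdL lam t.
have K0 : 0 < K by lra.
have lam0 : 0 < lam by rewrite divr_gt0 ?mulr_gt0.
have lam8 : lam <= 1 / 8 by rewrite ler_pdivrMr//; lra.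
have lamK : lam * K = 4 * L by rewrite /lam divfK ?gt_eqF.
have dlam : d%:R * lam ^+ 2 <= L / 16.
  rewrite /lam exprMn exprVn mulrA ler_pdivrMr ?exprn_gt0//.
  by have := ler_wpM2l (ltW L0) KdL; lra.
split=> //.
- by rewrite /t; lra.
- have : 4 / 5 * (lam * K) <= lam / (1 + 2 * lam) * K.
    rewrite [leRHS]mulrAC mulrC ler_pM2l ?lamK ?mulr_gt0//.
    by rewrite -[leRHS]mul1r ler_pdivlMr; lra.
  by rewrite lamK /t; lra.
Qed.

(** * Normalized residuals *)

(** The noise vectors are passed as a pair so that measurability is that of a
    function on a product space. *)
Definition residual (R : realType) (d : nat) (t t' : 'rV[R]_d) (r r' : R)
    (z : d.-tuple R * d.-tuple R) : R :=
  enorm (observation t r z.1 - observation t' r' z.2) ^+ 2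
  / (r ^+ 2 + r' ^+ 2).
Arguments residual {R d}.

Lemma enorm_sqr (R : realType) (d : nat) (v : 'rV[R]_d) :
  enorm v ^+ 2 = \sum_k v ord0 k ^+ 2.
Proof. by rewrite sqr_sqrtr// sumr_ge0// => k _; exact: sqr_ge0. Qed.

(** Normalizing by S makes the coefficients of the two noises satisfy
    (r / S)^2 + (- r' / S)^2 = 1. *)
Lemma residualE (R : realType) (d : nat) (t t' : 'rV[R]_d) (r r' : R) z :
  0 < r -> 0 < r' -> let S := Num.sqrt (r ^+ 2 + r' ^+ 2) in
  residual t t' r r' z =
  \sum_k ((t - t') ord0 k / S + r / S * tnth z.1 k + - r' / S * tnth z.2 k) ^+ 2.
Proof.
move=> r0 r'0 S; rewrite /residual.
have rr0 : 0 <= r ^+ 2 + r' ^+ 2 by rewrite addr_ge0 ?sqr_ge0.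
rewrite -[X in _ / X](sqr_sqrtr rr0) -/S enorm_sqr mulr_suml.
by apply: eq_bigr => k _; rewrite -exprVn -exprMn !mxE; congr (_ ^+ 2); ring.
Qed.

Lemma measurable_residual (R : realType) (d : nat) (t t' : 'rV[R]_d) (r r' : R) :
  measurable_fun setT (residual t t' r r').
Proof.
rewrite /residual; under eq_fun do rewrite enorm_sqr.
apply: measurable_funM => //; apply: measurable_sum => k.
apply: measurable_funX; under eq_fun do rewrite !mxE.
apply: measurable_funB; apply: measurable_funD => //; apply: measurable_funM => //.
  by apply: (measurableT_comp (measurable_tnth k)).
by apply: (measurableT_comp (measurable_tnth k)).
Qed.

(** The offset b carries the threshold of the Chernoff bound. *)
Lemma expectation_expR_residual_le (disp : measure_display)
    (T : measurableType disp) (R : realType) (P : probability T R) (d : nat)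
    (X Y : {RV P >-> d.-tuple R}) (t t' : 'rV[R]_d) (r r' a b : R) :
  standard_gaussian X -> standard_gaussian Y ->
  independent_pair P X Y ->
  0 < r -> 0 < r' -> `|a| <= 1 / 8 ->
  (\int[P]_w (expR (a * residual t t' r r' (X w, Y w) + b))%:E <=
   (expR (d%:R * (a + 2 * a ^+ 2)
          + a / (1 - 2 * a)
            * (enorm (t - t') / Num.sqrt (r ^+ 2 + r' ^+ 2)) ^+ 2 + b))%:E)%E.
Proof.
move=> gX gY indXY r0 r'0 a8; set S := Num.sqrt _.
have rr0 : 0 < r ^+ 2 + r' ^+ 2 by rewrite addr_gt0 ?exprn_gt0.
have S0 : 0 < S by rewrite sqrtr_gt0.
have S2 : S ^+ 2 = r ^+ 2 + r' ^+ 2 by rewrite sqr_sqrtr ?ltW.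
under eq_integral do rewrite expRD mulrC EFinM.
rewrite ge0_integralZl//; last 1 first.
  apply/measurable_EFinP; apply: (measurableT_comp (@measurable_expR R)).
  apply: measurable_funM => //.
  apply: (measurableT_comp (measurable_residual _ _ _ _ _ _)).
  exact: measurable_fun_pair.
rewrite expRD mulrC EFinM lee_wpmul2l ?lee_fin ?expR_ge0//.
under eq_integral do rewrite residualE//.
rewrite (le_trans (expectation_expR_sqr_gaussian_le _ _ _ _ _ _ _ (r / S)
  (- r' / S) a (fun k => (t - t') ord0 k / S) gX gY indXY _ a8))//.
  by rewrite !expr_div_n sqrrN -mulrDl S2 divff// gt_eqF.
rewrite lee_fin ler_expR expr_div_n enorm_sqr mulr_suml.
by rewrite (eq_bigr _ (fun k _ => expr_div_n _ _ _)).
Qed.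

(** X, Y and Z are the noises of X_i, of its true match and of a wrong candidate.
    The level s splits the comparison into an event on (X, Y) and one on (X, Z),
    so it is the independence of these two pairs that enters. *)
Lemma probability_residual_le (disp : measure_display)
    (T : measurableType disp) (R : realType) (P : probability T R) (d : nat)
    (X Y Z : {RV P >-> d.-tuple R}) (t t' : 'rV[R]_d) (r r' L : R) :
  standard_gaussian X -> standard_gaussian Y -> standard_gaussian Z ->
  independent_pair P X Y ->
  independent_pair P X Z ->
  0 < r -> 0 < r' -> 0 < L ->
  let K := (enorm (t - t') / Num.sqrt (r ^+ 2 + r' ^+ 2)) ^+ 2 in
  32 * L <= K -> 256 * (d%:R * L) <= K ^+ 2 ->
  measurable [set w | residual t t' r r' (X w, Z w)
                      <= residual t t r r (X w, Y w)] /\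
  (P [set w | (residual t t' r r' (X w, Z w)
               <= residual t t r r (X w, Y w))%R] <= (2 * expR (- L))%:E)%E.
Proof.
move=> gX gY gZ iXY iXZ r0 r'0 L0 K KL KdL.
pose V w : R := residual t t r r (X w, Y w).
pose W w : R := residual t t' r r' (X w, Z w).
have mV : measurable_fun setT V.
  apply: (measurableT_comp (measurable_residual _ _ _ _ _ _)).
  exact: measurable_fun_pair.
have mW : measurable_fun setT W.
  apply: (measurableT_comp (measurable_residual _ _ _ _ _ _)).
  exact: measurable_fun_pair.
pose B := [set w | W w <= V w].
have mB : measurable B.
  have -> : B =
      [set: T] `&` (fun w => W w <= V w) @^-1` [set true] by rewrite setTI.
  by apply: measurable_fun_ler.
split => //.
have [lam0 lam8 exV exW] := chernoff_exponents _ _ _ _ L0 KL KdL.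
set lam := 4 * L / K in lam0 lam8 exV exW.
set s := d%:R + 3 / 8 * K in exV exW.
pose G w : R := expR (lam * V w + - (lam * s)).
pose H w : R := expR (- lam * W w + lam * s).
have mG : measurable_fun setT G.
  apply: (measurableT_comp (@measurable_expR R)).
  by apply: measurable_funD => //; exact: measurable_funM.
have mH : measurable_fun setT H.
  apply: (measurableT_comp (@measurable_expR R)).
  by apply: measurable_funD => //; exact: measurable_funM.
have intG : (\int[P]_w (G w)%:E <= (expR (- L))%:E)%E.
  have lamn : `|lam| <= 1 / 8 by rewrite gtr0_norm.
  apply: (le_trans (expectation_expR_residual_le _ _ _ _ _ _ _ t t r r lam
    (- (lam * s)) gX gY iXY r0 r0 lamn)).
  rewrite lee_fin ler_expR subrr.
  have -> : enorm (0 : 'rV[R]_d) = 0.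
    by apply/eqP; rewrite -sqrf_eq0 enorm_sqr big1// => k _; rewrite mxE expr0n.
  by rewrite mul0r expr0n/= mulr0 addr0.
have intH : (\int[P]_w (H w)%:E <= (expR (- L))%:E)%E.
  have lamn : `|- lam| <= 1 / 8 by rewrite normrN gtr0_norm.
  apply: (le_trans (expectation_expR_residual_le _ _ _ _ _ _ _ t t' r r' (- lam)
    (lam * s) gX gZ iXZ r0 r'0 lamn)).
  by rewrite lee_fin ler_expR -/K sqrrN mulrN opprK mulNr mulNr.
(* On the event, G >= 1 if V >= s, and H >= 1 otherwise since then W <= V < s. *)
apply: (@le_trans _ _ (\int[P]_w ((G w)%:E + (H w)%:E))%E).
  apply: (@le_trans _ _ (\int[P]_w (\1_B w)%:E)%E).
    by rewrite integral_indic// setIT.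
  apply: ge0_le_integral => //.
  - exact/measurable_EFinP/measurable_indic.
  - by apply: emeasurable_funD; exact/measurable_EFinP.
  - move=> w _; rewrite -EFinD lee_fin indicE.
    case: (boolP (w \in _)) => [|_]; last by rewrite addr_ge0 ?expR_ge0.
    rewrite inE/= => WV; have [Vs|sV] := leP s (V w).
      rewrite (@le_trans _ _ (G w))// ?lerDl ?expR_ge0//.
      by rewrite -expR0 ler_expR subr_ge0 ler_pM2l.
    rewrite (@le_trans _ _ (H w))// ?lerDr ?expR_ge0//.
    rewrite -expR0 ler_expR mulNr addrC subr_ge0 ler_pM2l//.
    exact: le_trans WV (ltW sV).
rewrite ge0_integralD//.
- by rewrite mulr_natl mulr2n EFinD leeD.
- by move=> w _; rewrite lee_fin expR_ge0.
- exact/measurable_EFinP.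
- by move=> w _; rewrite lee_fin expR_ge0.
- exact/measurable_EFinP.
Qed.

(** * From the minimizer to a comparison of two residuals *)

Lemma exists_le_of_sum_le (R : realDomainType) (I : finType) (Q : pred I)
    (F G : I -> R) :
  (exists i, Q i) -> (forall i, ~~ Q i -> F i = G i) ->
  \sum_i F i <= \sum_i G i -> exists2 i, Q i & F i <= G i.
Proof.
move=> [i0 Qi0] FG le_sum; apply: contrapT => noi.
have ltQ i : Q i -> G i < F i.
  by move=> Qi; rewrite ltNge; apply/negP => FGi; apply: noi; exists i.
have : \sum_i G i < \sum_i F i.
  rewrite (bigD1 i0)//= [ltRHS](bigD1 i0)//= ltr_leD ?ltQ//.
  apply: ler_sum => i _; have [/ltQ/ltW//|/FG->//] := boolP (Q i).
by rewrite ltNge le_sum.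
Qed.

Lemma lsns_neq_exists_le (R : realType) (n m d : nat) (sigma : 'I_n -> R)
    (sigmas : 'I_m -> R) (x : 'I_n -> 'rV[R]_d) (xs : 'I_m -> 'rV[R]_d)
    (f g : {ffun 'I_n -> 'I_m}) :
  is_lsns sigma sigmas x xs f -> injective g -> f <> g ->
  exists2 i, f i != g i &
    enorm (x i - xs (f i)) ^+ 2 / (sigma i ^+ 2 + sigmas (f i) ^+ 2) <=
    enorm (x i - xs (g i)) ^+ 2 / (sigma i ^+ 2 + sigmas (g i) ^+ 2).
Proof.
move=> [_ minf] injg fg; apply: exists_le_of_sum_le; last exact: minf.
  apply: contrapT => nfg; apply: fg; apply/ffunP => i.
  by apply/eqP; apply/negPn/negP => figi; apply: nfg; exists i.
by move=> i /negPn/eqP ->.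
Qed.

Lemma noise_family_independent_pair (disp : measure_display) (T : measurableType disp)
    (R : realType) (P : probability T R) (n m d : nat)
    (xi : 'I_n -> {RV P >-> d.-tuple R}) (xis : 'I_m -> {RV P >-> d.-tuple R}) :
  mutually_independent P (noise_family xi xis) ->
  forall i j, independent_pair P (xi i) (xis j).
Proof.
move=> ind i j A B mA mB.
pose C (k : 'I_n + 'I_m) := if k is inl _ then A else B.
have mC k : measurable (C k) by case: k.
have := ind [set inl i; inr j]%SET C mC.
rewrite big_setU1 ?inE//= big_set1/= => <-; congr (P _).
apply/seteqP; split => [w [Aw Bw] k|w Cw].
  by rewrite !inE => /orP[] /eqP->.
by split; [apply: (Cw (inl i))|apply: (Cw (inr j))]; rewrite !inE eqxx ?orbT.
Qed.

Lemma kappa_le_separation (R : realType) (n m d : nat)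
    (thetas : 'I_m -> 'rV[R]_d) (sigmas : 'I_m -> R)
    (pistar : {ffun 'I_n -> 'I_m}) (i : 'I_n) (j : 'I_m) :
  j != pistar i ->
  (Order.min (kappa_in_in thetas sigmas pistar)
             (kappa_in_out thetas sigmas pistar)
   <= (separation thetas sigmas (pistar i) j)%:E)%E.
Proof.
move=> ji; have iin : pistar i \notin outliers pistar.
  by rewrite inE negbK; apply/imsetP; exists i.
rewrite ge_min; have [jout|jin] := boolP (j \in outliers pistar).
  apply/orP; right; rewrite /kappa_in_out.
  apply: (bigmin_le_cond (j := (pistar i, j)) +oo%E
    (fun p => (separation thetas sigmas p.1 p.2)%:E)).
  by rewrite /= iin.
apply/orP; left; rewrite /kappa_in_in.
apply: (bigmin_le_cond (j := (pistar i, j)) +oo%E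
  (fun p => (separation thetas sigmas p.1 p.2)%:E)).
by rewrite /= iin jin eq_sym.
Qed.

(** The fourth and second powers of the two terms of the maximum give the bounds
    on K = x^2 that the Chernoff exponents use. *)
Lemma separation_sqr_bounds (R : realType) (d : nat) (L1 L2 x : R) :
  0 < L1 -> L1 <= L2 ->
  4 * Num.max ((d%:R * L1) `^ (1 / 4)) ((2 * L2) `^ (1 / 2)) <= x ->
  32 * L1 <= x ^+ 2 /\ 256 * (d%:R * L1) <= (x ^+ 2) ^+ 2.
Proof.
move=> L10 L12.
set p := _ `^ (1 / 4); set q := _ `^ (1 / 2) => hx.
have dL0 : 0 <= d%:R * L1 by rewrite mulr_ge0// ltW.
have p4 : p ^+ 4 = d%:R * L1.
  rewrite -powR_mulrn ?powR_ge0// -powRrM.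
  by rewrite divfK// powRr1.
have q2 : q ^+ 2 = 2 * L2.
  rewrite -powR_mulrn ?powR_ge0// -powRrM divfK// powRr1//.
  by lra.
have px : 4 * p <= x by apply: le_trans hx; rewrite ler_pM2l// le_max lexx.
have qx : 4 * q <= x by apply: le_trans hx; rewrite ler_pM2l// le_max lexx orbT.
have p0 : 0 <= p := powR_ge0 _ _.
have q0 : 0 <= q := powR_ge0 _ _.
have x0 : 0 <= x by lra.
split.
  apply: (@le_trans _ _ ((4 * q) ^+ 2)); first by rewrite exprMn q2; lra.
  by rewrite lerXn2r ?nnegrE// mulr_ge0.
rewrite -p4 -exprM; apply: (@le_trans _ _ ((4 * p) ^+ 4)).
  by rewrite exprMn; lra.
by rewrite lerXn2r ?nnegrE// mulr_ge0.
Qed.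

(** * Recovery of the matching *)

Theorem theorem1 (R : realType) (n m d : nat)
    (hn : (2 <= n)%N) (hnm : (n < m)%N) (hd : (1 <= d)%N)
    (thetas : 'I_m -> 'rV[R]_d) (sigmas : 'I_m -> R)
    (hsigmas : forall j, 0 < sigmas j)
    (pistar : {ffun 'I_n -> 'I_m}) (hpistar : injective pistar)
    (disp : measure_display) (T : measurableType disp) (P : probability T R)
    (xi : 'I_n -> {RV P >-> d.-tuple R}) (xis : 'I_m -> {RV P >-> d.-tuple R})
    (hxi : independent_standard_gaussians xi xis)
    (pihat : T -> {ffun 'I_n -> 'I_m})
    (hpihat : forall w : T,
       is_lsns (fun i => sigmas (pistar i)) sigmas
         (fun i => observation (thetas (pistar i)) (sigmas (pistar i)) (xi i w))
         (fun j => observation (thetas j) (sigmas j) (xis j w))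
         (pihat w))
    (hmeas : measurable [set w | pihat w = pistar])
    (alpha : R) (halpha : 0 < alpha < 1)
    (hkappa :
       ((4 * Num.max
               ((d%:R * ln (4 * n%:R * m%:R / alpha)) `^ (1 / 4))
               ((2 * ln (8 * n%:R * m%:R / alpha)) `^ (1 / 2)))%:E
        <= Order.min (kappa_in_in thetas sigmas pistar)
                     (kappa_in_out thetas sigmas pistar))%E) :
  ((1 - alpha)%:E <= P [set w | pihat w = pistar])%E.
Proof.
have [gxi gxis indxi] := hxi; have /andP[a0 a1] := halpha.
have n1 : 1 <= n%:R :> R by rewrite ler1n (leq_trans _ hn).
have m1 : 1 <= m%:R :> R by rewrite ler1n (leq_trans _ hnm).
have nm1 : 1 <= n%:R * m%:R :> R by rewrite -[leLHS]mulr1 ler_pM.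
have nm4 : 1 < 4 * n%:R * m%:R / alpha :> R by rewrite ltr_pdivlMr//; lra.
set L := ln (4 * n%:R * m%:R / alpha) in hkappa.
have L0 : 0 < L by rewrite ln_gt0.
have L12 : L <= ln (8 * n%:R * m%:R / alpha).
  rewrite ler_ln ?posrE; last 2 first.
  - by rewrite divr_gt0// -mulrA mulr_gt0//; lra.
  - by rewrite divr_gt0// -mulrA mulr_gt0//; lra.
  by rewrite ler_pM2r ?invr_gt0//; lra.
have expL : expR (- L) = alpha / (4 * (n%:R * m%:R)).
  by rewrite expRN lnK ?posrE ?(lt_trans _ nm4)// invf_div mulrA.
pose Q (p : 'I_n * 'I_m) := p.2 != pistar p.1.
pose t i := thetas (pistar i); pose r i := sigmas (pistar i).
pose B (p : 'I_n * 'I_m) := [set w |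
  residual (t p.1) (thetas p.2) (r p.1) (sigmas p.2) (xi p.1 w, xis p.2 w) <=
  residual (t p.1) (t p.1) (r p.1) (r p.1) (xi p.1 w, xis (pistar p.1) w)].
have BP p : Q p -> measurable (B p) /\ (P (B p) <= (2 * expR (- L))%:E)%E.
  case: p => i j; rewrite /Q /B/= => ji.
  have ind k := noise_family_independent_pair _ _ _ _ _ _ _ _ _ indxi i k.
  have := le_trans hkappa (kappa_le_separation _ _ _ _ thetas sigmas _ _ _ ji).
  rewrite lee_fin => /(separation_sqr_bounds _ _ _ _ _ L0 L12)[KL KdL].
  exact: (probability_residual_le _ _ _ _ _ (xi i) (xis (pistar i)) (xis j)
    _ _ _ _ L (gxi i) (gxis _) (gxis j) (ind _) (ind j)
    (hsigmas _) (hsigmas j) L0 KL KdL).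
have sub : ~` [set w | pihat w = pistar] `<=` \bigcup_(p in [set` Q]) B p.
  move=> w /= neq.
  have [i ne le] := lsns_neq_exists_le _ _ _ _ _ _ _ _ _ _ (hpihat w) hpistar neq.
  by exists (i, pihat w i).
have PC : (P (~` [set w | pihat w = pistar]) <= alpha%:E)%E.
  apply: (@le_trans _ _ (\sum_(p \in [set` Q]) P (B p))%E).
    apply: content_sub_fsum => //; last exact: measurableC.
    by move=> p Qp; have [] := BP p Qp.
  rewrite -(bigfs _ (index_enum_uniq _))//; last first.
    by move=> p _; rewrite mem_index_enum.
  apply: (@le_trans _ _ (\sum_(p | Q p) (2 * expR (- L))%:E)%E).
    by apply: lee_sum => p /BP[].
  rewrite sumEFin lee_fin sumr_const expL.
  apply: (@le_trans _ _ ((2 * (alpha / (4 * (n%:R * m%:R)))) *+ (n * m))).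
    rewrite ler_wpMn2l//; first by rewrite mulr_ge0// divr_ge0//; lra.
    by rewrite (leq_trans (max_card _))// card_prod !card_ord.
  rewrite -mulr_natr natrM.
  have -> : 2 * (alpha / (4 * (n%:R * m%:R))) * (n%:R * m%:R) = alpha / 2 :> R.
    by field; apply/andP; split; rewrite gt_eqF//; lra.
  by lra.
rewrite -[X in P X]setCK probability_setC; last exact: measurableC.
by rewrite EFinB leeB.
Qed.
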